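(* Let $(\mathfrak g,[\cdot,\cdot]_{\mathfrak g},\omega)$ be a quadratic Leibniz algebra and $K:\mathfrak g^*\to\mathfrak g$ a linear map. Let $\omega^\natural:\mathfrak g\to\mathfrak g^*$ be given by $\langle\omega^\natural(x),y\rangle=\omega(x,y)$. Then $K$ is a relative Rota–Baxter operator on $(\mathfrak g,[\cdot,\cdot]_{\mathfrak g})$ with respect to the representation $(\mathfrak g^*;L^*,-L^*-R^* )$ if and only if $K\circ\omega^\natural$ is a Rota–Baxter operator on $(\mathfrak g,[\cdot,\cdot]_{\mathfrak g})$.
   Context: All vector spaces are finite-dimensional over an algebraically closed field $\mathbb K$ of characteristic $0$. A Leibniz algebra is a vector space with a bilinear operation satisfying $[x,[y,z]]=[[x,y],z]+[y,[x,z]]$. A quadratic Leibniz algebra is a Leibniz algebra with a nondegenerate skew-symmetric bilinear form $\omega$ satisfying $\omega(x,[y,z]_{\mathfrak g})=\omega([x,z]_{\mathfrak g}+[z,x]_{\mathfrak g},y)$ for all $x,y,z$. $L^*,R^*:\mathfrak g\to\mathfrak{gl}(\mathfrak g^* )$ are defined by $\langle L_x^*\xi,y\rangle=-\langle\xi,[x,y]_{\mathfrak g}\rangle$, $\langle R_x^*\xi,y\rangle=-\langle\xi,[y,x]_{\mathfrak g}\rangle$; $(\mathfrak g^*;L^*,-L^*-R^* )$ is a representation of $\mathfrak g$. A relative Rota–Baxter operator with respect to it is a linear map $K:\mathfrak g^*\to\mathfrak g$ with $[K\xi,K\eta]_{\mathfrak g}=K(L^*_{K\xi}\eta-L^*_{K\eta}\xi-R^*_{K\eta}\xi)$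 for all $\xi,\eta$. A Rota–Baxter operator on $\mathfrak g$ is a linear map $T:\mathfrak g\to\mathfrak g$ with $[T(x),T(y)]_{\mathfrak g}=T([T(x),y]_{\mathfrak g}+[x,T(y)]_{\mathfrak g})$ for all $x,y$. *)

(* Defs.v *)
From HB Require Import structures.
From mathcomp Require Import all_boot all_order all_algebra.

Set Implicit Arguments.
Unset Strict Implicit.
Unset Printing Implicit Defensive.

Import GRing.Theory.
Local Open Scope ring_scope.

Section LinfunLinear.
Variables (F : fieldType) (U V : vectType F).

(* Variant of lfunE with linearity as a hypothesis rather than an instance. *)
Lemma linfunE (f : U -> V) : linear f -> linfun f =1 f.
Proof.
move=> flin u.
pose mf := GRing.isLinear.Build F U V *:%R f flin.
pose fL : {linear U -> V} := HB.pack f mf.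
exact: (lfunE fL).
Qed.

End LinfunLinear.

Section LeibnizAlgebras.
Variables (F : fieldType) (g : vectType F).

Definition dual : vectType F := 'Hom(g, F^o).

Section Bracket.
Variable br : {bilinear g -> g -> g}.

Definition leibniz : Prop :=
  forall x y z : g, br x (br y z) = br (br x y) z + br y (br x z).

Definition quadratic_invariant (omega : g -> g -> F) : Prop :=
  forall x y z : g, omega x (br y z) = omega (br x z + br z x) y.

Definition Lstar (x : g) : 'End(dual) :=
  linfun (fun xi : dual => - (xi \o linfun (br x))%VF : dual).

Definition Rstar (x : g) : 'End(dual) :=
  linfun (fun xi : dual => - (xi \o linfun (applyr br x))%VF : dual).

Lemma LstarE (x : g) (xi : dual) (y : g) : Lstar x xi y = - xi (br x y).
Proof.
rewrite /Lstar linfunE => [|a u v]; first by rewrite !lfunE /= lfunE /= lfunE.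
by rewrite comp_lfunDl -comp_lfunZl opprD scalerN.
Qed.

Lemma RstarE (x : g) (xi : dual) (y : g) : Rstar x xi y = - xi (br y x).
Proof.
rewrite /Rstar linfunE => [|a u v]; first by rewrite !lfunE /= lfunE /= lfunE.
by rewrite comp_lfunDl -comp_lfunZl opprD scalerN.
Qed.

(* Relative Rota-Baxter operators for the representation
   (dual; Lstar, - Lstar - Rstar). *)
Definition relative_rota_baxter (K : 'Hom(dual, g)) : Prop :=
  forall xi eta : dual,
    br (K xi) (K eta)
    = K (Lstar (K xi) eta - Lstar (K eta) xi - Rstar (K eta) xi).

Definition rota_baxter (T : 'End(g)) : Prop :=
  forall x y : g, br (T x) (T y) = T (br (T x) y + br x (T y)).

End Bracket.

Definition natural_map (omega : {skew_symmetric g}) : 'Hom(g, dual) :=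
  linfun (fun x : g => linfun (omega x : g -> F^o) : dual).

Lemma natural_mapE (omega : {skew_symmetric g}) (x y : g) :
  natural_map omega x y = omega x y.
Proof.
have linr u : linear (omega u : g -> F^o) by move=> a v w; exact: linearPr.
rewrite /natural_map linfunE => [|a u v]; first by rewrite linfunE.
apply/lfunP => z; rewrite add_lfunE scale_lfunE !linfunE //.
exact: linearPl.
Qed.

Definition quadratic_leibniz (br : {bilinear g -> g -> g})
    (omega : {skew_symmetric g}) : Prop :=
  [/\ leibniz br, nondegenerate omega & quadratic_invariant br omega].

End LeibnizAlgebras.

(* Main.v *)
Require Import Defs.
From mathcomp Require Import all_boot all_order all_algebra.

Set Implicit Arguments.
Unset Strict Implicit.
Unset Printing Implicit Defensive.

Import GRing.Theory.
Local Open Scope ring_scope.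

(* Skew-symmetry and invariance make the isomorphism omega^natural intertwine the
   regular representation (g; L, R) with (g^*; L^*, - L^* - R^* ), so it
   transports one Rota-Baxter identity to the other. *)

Lemma skew_symmetricC (F : fieldType) (g : vectType F)
    (omega : {skew_symmetric g}) (x y : g) : omega x y = - omega y x.
Proof. by rewrite hermC /= expr1 mulN1r. Qed.

(** The kernel is the radical of [omega], which nondegeneracy makes zero; a dimension count does the
    rest. *)
Lemma natural_map_bij (F : fieldType) (g : vectType F)
    (omega : {skew_symmetric g}) :
  nondegenerate omega -> bijective (natural_map omega).
Proof.
move=> /eqP rad0.
have ker0 : lker (natural_map omega) == 0%VS.
  apply/eqP/vspaceP => x; rewrite -rad0; apply/idP/idP.
    rewrite memv_ker => /eqP natx0; apply/mem_orthovP => y _.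
    by rewrite -natural_mapE natx0 zero_lfunE.
  move/mem_orthovP => radx; rewrite memv_ker; apply/eqP/lfunP => y.
  by rewrite natural_mapE zero_lfunE radx ?memvf.
(* [F^o] has dimension 1, so [dual g] has the dimension of [g] and injectivity forces
   surjectivity. *)
have imgT : limg (natural_map omega) = fullv.
  apply/eqP; rewrite eqEdim subvf (limg_dim_eq (eqP _)) ?dimvf.
    by rewrite /dim /= muln1.
  by rewrite (eqP ker0) capv0.
exists (natural_map omega)^-1%VF; first exact: lker0_lfunK.
by move=> xi; apply: limg_lfunVK; rewrite imgT memvf.
Qed.

Section Intertwining.
Variables (F : fieldType) (g : vectType F) (br : {bilinear g -> g -> g}).
Variable omega : {skew_symmetric g}.
Hypothesis inv : quadratic_invariant br omega.

(** At [z], invariance brings both sides to [- omega (br y z + br z y) x], the symmetrized bracket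
    being insensitive to order. *)
Lemma natural_map_Lstar (x y : g) :
  natural_map omega (br x y) = Lstar br x (natural_map omega y).
Proof.
apply/lfunP => z; rewrite LstarE !natural_mapE skew_symmetricC inv.
by rewrite [in RHS]inv [br z y + _]addrC -skew_symmetricC skew_symmetricC.
Qed.

(** At [z], both sides become [omega x (br y z + br z y)]; its summands are the [Lstar] and [Rstar]
    terms, their double signs cancelling. *)
Lemma natural_map_Rstar (x y : g) :
  natural_map omega (br x y)
  = - Lstar br y (natural_map omega x) - Rstar br y (natural_map omega x).
Proof.
apply/lfunP => z.
rewrite add_lfunE !opp_lfunE LstarE RstarE !opprK !natural_mapE -linearDr /=.
by rewrite skew_symmetricC inv -skew_symmetricC addrC.
Qed.

End Intertwining.

Theorem theorem4p17 (F : closedFieldType) (charF0 : [pchar F] =i pred0)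
    (g : vectType F) (br : {bilinear g -> g -> g})
    (omega : {skew_symmetric g})
    (quad : quadratic_leibniz br omega)
    (K : 'Hom(dual g, g)) :
  relative_rota_baxter br K
  <-> rota_baxter br (K \o natural_map omega)%VF.
Proof.
have [_ ndeg inv] := quad.
(* The right side of the Rota-Baxter identity at [x], [y] is that of the relative one at their
   images. *)
have transport x y :
    (K \o natural_map omega)%VF
      (br ((K \o natural_map omega)%VF x) y
       + br x ((K \o natural_map omega)%VF y))
    = let xi := natural_map omega x in let eta := natural_map omega y in
      K (Lstar br (K xi) eta - Lstar br (K eta) xi - Rstar br (K eta) xi).
  rewrite !comp_lfunE linearD /= natural_map_Lstar // natural_map_Rstar //.
  by rewrite addrA.
split=> [rrb x y | rb xi eta].
  by rewrite transport !comp_lfunE; apply: rrb.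
(* Surjectivity is what makes the identity on images cover all [xi], [eta]. *)
have [inv_nat _ natK] := natural_map_bij ndeg.
by have := rb (inv_nat xi) (inv_nat eta); rewrite transport !comp_lfunE /= !natK.
Qed.
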